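(* Let $\{x^k\}$ be generated by the coordinate descent algorithm described in the context, with index sets $I_k$, restricted functions $f_k(z)=f(x^k[z])$, restricted boxes $\Omega_k$, base points $\bar x^k=x^k_{I_k}$, models $M_k$ and returned regularization parameters $\sigma_k$. Assume: (1) there exists $L>0$ such that, for every iteration $k$ and every trial point $z=z^{\mathrm{trial}}$ computed at iteration $k$, $$\|\nabla f_k(z)-\nabla M_k(z)\|\le L\|z-\bar x^k\|^p,\qquad M_k(\bar x^k)=f_k(\bar x^k),\qquad f_k(z)\le M_k(z)+L\|z-\bar x^k\|^{p+1};$$ (2) at every iteration $k$, $M_k$ is the Taylor polynomial of order $p$ of $f_k$ around $\bar x^k$, and the derivatives of $f$ (with respect to the variables $x_i$, $i\in I_k$) involved in this Taylor polynomial exist and are continuous at all $x\in\Omega$; (3) at every iteration $k$, the accepted point $x^{k+1}_{I_k}$ is computed as a global minimizer of $M_k(z)+\sigma\|z-\bar x^k\|^{p+1}$ subject to $z\in\Omega_k$, where $\sigma=\sigma_k$ is the current regularization parameter. Let $K$ be an infinite set of indices and $I\subseteq\{1,\dots,n\}$ a nonempty set such that $I_k=I$ for all $k\in K$, and let $x^*$ be a limit point of $\{x^k\}_{k\in K}$. Consider the problem of minimizing $\underline f(z)$ over $z\in\underline\Omega$, where $\underline\Omega=\{z\in\mathbb{R}^{|I|}: \ell_I\le z\le u_I\}$ and $\underline f(z)$ is the value of $f$ at the point whose components with indices in $I$ are those of $z$ and whose remaining components are those of $x^*$. Then, for all $j\le p$, $x^*_I$ is $j$th-order stationary of $\underline f$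 over $\underline\Omega$, and it is also $j$th-order $\sigma$-stationary of $\underline f$ over $\underline\Omega$ for some $\sigma\le\tau_2(L+\alpha)$.
   Context: $\|\cdot\|$ is the Euclidean norm. Let $\Omega=\{x\in\mathbb{R}^n:\ell\le x\le u\}$ with $\ell,u\in\mathbb{R}^n$, $\ell<u$ componentwise, and let $f$ have continuous first derivatives over $\Omega$. $P_C$ denotes Euclidean projection onto a closed convex set $C$. For $v\in\mathbb{R}^n$ and $I\subseteq\{1,\dots,n\}$, $v_I\in\mathbb{R}^{|I|}$ is the subvector of components with indices in $I$. Coordinate descent algorithm. Given: $p\in\{1,2,3,\dots\}$, $\alpha>0$, $\sigma_{\min}>0$, $\tau_2\ge\tau_1>1$, $\theta>0$, $x^0\in\Omega$. At each iteration $k=0,1,2,\dots$: choose a nonempty $I_k\subseteq\{1,\dots,n\}$. For $z\in\mathbb{R}^{|I_k|}$ let $x^k[z]$ be the vector with $(x^k[z])_{I_k}=z$ and $(x^k[z])_i=x^k_i$ for $i\notin I_k$. Put $f_k(z)=f(x^k[z])$, $\Omega_k=\{z\in\mathbb{R}^{|I_k|}:\ell_{I_k}\le z\le u_{I_k}\}$, $\bar x^k=x^k_{I_k}$, and let $M_k:\mathbb{R}^{|I_k|}\to\mathbb{R}$ be a model of $f_k$ around $\bar x^k$ whose gradient exists on $\Omega_k$. Step 1: set $\sigma\leftarrow 0$. Step 2: compute a trial point $z^{\mathrm{trial}}\in\Omega_k$ with $M_k(z^{\mathrm{trial}})+\sigma\|z^{\mathrm{trial}}-\bar x^k\|^{p+1}\le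 M_k(\bar x^k)$ and $$\Big\|P_{\Omega_k}\big[z^{\mathrm{trial}}-\nabla\big(M_k(z)+\sigma\|z-\bar x^k\|^{p+1}\big)\big|_{z=z^{\mathrm{trial}}}\big]-z^{\mathrm{trial}}\Big\|\le\theta\|z^{\mathrm{trial}}-\bar x^k\|^p.$$ Step 3: if $f_k(z^{\mathrm{trial}})\le f_k(\bar x^k)-\alpha\|z^{\mathrm{trial}}-\bar x^k\|^{p+1}$, accept it: set $x^{k+1}=x^k[z^{\mathrm{trial}}]$, $\sigma_k=\sigma$, and go to iteration $k+1$. Otherwise set $\sigma\leftarrow\max\{\sigma_{\min},\tau\sigma\}$ with some $\tau\in[\tau_1,\tau_2]$ and return to Step 2. For a function $h$ on $\mathbb{R}^m$ (or a subset of it) admitting continuous derivatives up to order $j$, $T_j(x^*,x)$ denotes its Taylor polynomial of order $j$ around $x^*$. Definition ($j$th-order stationary). $x^*\in C$ is $j$th-order stationary of $h$ over the closed convex set $C$ if, for all $x\in C$, $0$ is a local minimizer of the Taylor polynomial of order $j$ (around $t=0$) of the univariate function $\varphi(t)=h(x^*+t(x-x^* ))$, restricted to those $t$ with $x^*+t(x-x^* )\in C$. Definition ($j$th-order $\sigma$-stationary). Assume that $D\subset\mathbb{R}^m$, $h:D\to\mathbb{R}$, $x^*$ is such that $h(x)\le T_j(x^*,x)+\gamma\|x-x^*\|^{j+1}$ for all $x\in D$, and $\sigma\ge\gamma$. Then $x^*\in D$ is $j$th-order $\sigma$-stationary of $h$ over $D$ if $x^*$ is a local minimizer of $T_j(x^*,x)+\sigma\|x-x^*\|^{j+1}$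 over $x\in D$.
   Formalization: The bound τ2(L+α) is replaced by max{σ_min, τ2(L+α)}, and σ-stationarity is claimed only if f̲(z) ≤ T_j(x*_I,z)+γ‖z−x*_I‖^{j+1} on Ω̲ for some γ below that bound (local minimality for j=p needs no such γ); the literal claim is false. *)

(* Defs.v *)
From mathcomp Require Export all_boot all_order all_algebra.
From mathcomp Require Export all_classical all_reals all_analysis.
Export Order.TTheory GRing.Theory Num.Theory numFieldNormedType.Exports.

Set Implicit Arguments.
Unset Strict Implicit.
Unset Printing Implicit Defensive.

Local Open Scope classical_set_scope.
Local Open Scope ring_scope.

(* The library norm of 'rV[R]_n is the sup norm; it induces the same topology
   as the Euclidean norm, so limits and continuity are those of the library. *)
Definition enorm (R : realType) (n : nat) (v : 'rV[R]_n) : R :=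
  Num.sqrt (\sum_i v 0 i ^+ 2).

Definition box (R : realType) (n : nat) (l u : 'rV[R]_n) : set 'rV[R]_n :=
  [set x | forall i, l 0 i <= x 0 i <= u 0 i].

(* Euclidean projection; meaningful for C nonempty, closed and convex, where
   the minimizer selected by get is unique. *)
Definition eproj (R : realType) (n : nat) (C : set 'rV[R]_n) (y : 'rV[R]_n) :
    'rV[R]_n :=
  get [set w | C w /\ forall v, C v -> enorm (w - y) <= enorm (v - y)].

Section Subvectors.
Context {R : realType} {n : nat}.

(* v_I, with the elements of I listed in increasing order *)
Definition subvec (I : {set 'I_n}) (v : 'rV[R]_n) : 'rV[R]_#|I| :=
  \row_(a < #|I|) v 0 (enum_val a).

(* x[z]: the coordinates in I are those of z, the other ones those of x *)
Definition embed (I : {set 'I_n}) (x : 'rV[R]_n) (z : 'rV[R]_#|I|) : 'rV[R]_n :=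
  \row_i (if [pick a : 'I_#|I| | enum_val a == i] is Some a
          then z 0 a else x 0 i).

Definition restr (f : 'rV[R]_n -> R) (I : {set 'I_n}) (x : 'rV[R]_n)
    (z : 'rV[R]_#|I|) : R :=
  f (embed x z).

Definition subbox (l u : 'rV[R]_n) (I : {set 'I_n}) : set 'rV[R]_#|I| :=
  box (subvec I l) (subvec I u).

End Subvectors.

Arguments subbox {R n} l u I _.

(* Directional derivatives of a function whose domain is D: these are the
   library's derivable and derive, except that the increments t are restricted
   to those keeping the point inside D. They only depend on the values of the
   function on D, are one-sided at the boundary of a box, and agree with the
   library's 'D_v wherever the latter exist and D contains a segment issued
   from x in the direction v or -v. *)
Section DerivativesIn.
Context {R : realType} {V : normedModType R}.

Definition feasible_steps (D : set V) (x v : V) : set R :=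
  [set t | D (x + t *: v)].

Definition derivable_in (D : set V) (h : V -> R) (x v : V) : Prop :=
  cvg ((fun t : R => t^-1 * (h (x + t *: v) - h x))
         @ within (feasible_steps D x v) 0^').

Definition derive_in (D : set V) (v : V) (h : V -> R) (x : V) : R :=
  lim ((fun t : R => t^-1 * (h (x + t *: v) - h x))
         @ within (feasible_steps D x v) 0^').

Definition local_minimizer (D : set V) (g : V -> R) (x : V) : Prop :=
  D x /\ \forall y \near within D (nbhs x), g x <= g y.

Definition global_minimizer (D : set V) (g : V -> R) (x : V) : Prop :=
  D x /\ forall y, D y -> g x <= g y.

End DerivativesIn.

Section Multivariate.
Context {R : realType} {m : nat}.
Implicit Types (D : set 'rV[R]_m) (h : 'rV[R]_m -> R) (s : seq 'I_m).

Definition evec (i : 'I_m) : 'rV[R]_m := delta_mx 0 i.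

(* for a function defined on the whole space *)
Definition grad h (z : 'rV[R]_m) : 'rV[R]_m := \row_i 'D_(evec i) h z.

Definition grad_in D h (z : 'rV[R]_m) : 'rV[R]_m :=
  \row_i derive_in D (evec i) h z.

(* pderivs D h [:: i1; ...; ik] is the iterated partial derivative
   d^k h / dx_i1 ... dx_ik *)
Definition pderivs D h s : 'rV[R]_m -> R :=
  foldr (fun i g => derive_in D (evec i) g) h s.

(* All the partial derivatives of h with respect to the variables in I, up to
   the order j, exist and are continuous on D (order 0 being h itself). *)
Definition smooth_in D (I : {set 'I_m}) (j : nat) h : Prop :=
  (forall s i, all [in I] s -> i \in I -> (size s < j)%N ->
     forall x, D x -> derivable_in D (pderivs D h s) x (evec i)) /\
  (forall s, all [in I] s -> (size s <= j)%N ->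
     {within D, continuous (pderivs D h s)}).

(* The k-th order term is D^k h(xs)[x - xs, ..., x - xs] / k!, the k-linear
   form being expanded over all the k-tuples of indices. *)
Definition taylor D (j : nat) h (xs x : 'rV[R]_m) : R :=
  \sum_(k < j.+1) (k`!%:R)^-1 *
    \sum_(s : k.-tuple 'I_m)
      pderivs D h s xs * \prod_(i <- s) (x - xs) 0 i.

(* Taylor polynomial around 0 of a function of one variable with domain T *)
Definition taylor1 (T : set R) (j : nat) (phi : R -> R) (t : R) : R :=
  \sum_(k < j.+1)
    (k`!%:R)^-1 * iter k (derive_in (V := R^o) T 1) phi 0 * t ^+ k.

Definition stationary (j : nat) D h (xs : 'rV[R]_m) : Prop :=
  D xs /\ forall x, D x ->
    let T : set R := [set t | D (xs + t *: (x - xs))] in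
    let phi : R -> R := fun t => h (xs + t *: (x - xs)) in
    local_minimizer (V := R^o) T (taylor1 T j phi) 0.

Definition reg_taylor D (j : nat) (sigma : R) h (xs x : 'rV[R]_m) : R :=
  taylor D j h xs x + sigma * enorm (x - xs) ^+ j.+1.

Definition taylor_upper_bound (j : nat) (gamma : R) D h (xs : 'rV[R]_m) : Prop :=
  forall x, D x -> h x <= reg_taylor D j gamma h xs x.

Definition sigma_stationary (j : nat) (sigma : R) D h (xs : 'rV[R]_m) : Prop :=
  (exists2 gamma, gamma <= sigma & taylor_upper_bound j gamma D h xs) /\
  local_minimizer D (reg_taylor D j sigma h xs) xs.

End Multivariate.

Section CoordinateDescent.
Context {R : realType} {n : nat}.
Variables (l u : 'rV[R]_n) (f : 'rV[R]_n -> R).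
Variables (p : nat) (alpha sigma_min tau1 tau2 theta : R).

Definition reg_model (m : nat) (M : 'rV[R]_m -> R) (xb : 'rV[R]_m) (sigma : R)
    (z : 'rV[R]_m) : R :=
  M z + sigma * enorm (z - xb) ^+ p.+1.

Definition trial_point (I : {set 'I_n}) (x : 'rV[R]_n) (M : 'rV[R]_#|I| -> R)
    (sigma : R) (z : 'rV[R]_#|I|) : Prop :=
  let xb := subvec I x in
  [/\ subbox l u I z,
      reg_model M xb sigma z <= M xb &
      enorm (eproj (subbox l u I) (z - grad (reg_model M xb sigma) z) - z)
        <= theta * enorm (z - xb) ^+ p].

Definition sufficient_descent (I : {set 'I_n}) (x : 'rV[R]_n)
    (z : 'rV[R]_#|I|) : Prop :=
  restr f x z <= restr f x (subvec I x) - alpha * enorm (z - subvec I x) ^+ p.+1.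

(* One iteration leading from x to x': z i and sigma i are the trial point and
   the regularization parameter of the i-th attempt. The attempts i < r are
   rejected and the attempt r is accepted. *)
Definition cd_iteration (x x' : 'rV[R]_n) (I : {set 'I_n})
    (M : 'rV[R]_#|I| -> R) (r : nat) (z : nat -> 'rV[R]_#|I|)
    (sigma : nat -> R) : Prop :=
  [/\ I != finset.set0 /\ (forall y, subbox l u I y -> differentiable M y),
      sigma 0%N = 0 /\
        (forall i, (i < r)%N -> exists2 tau, tau1 <= tau <= tau2 &
           sigma i.+1 = Num.max sigma_min (tau * sigma i)),
      forall i, (i <= r)%N -> trial_point x M (sigma i) (z i),
      forall i, (i < r)%N -> ~ sufficient_descent x (z i) &
      sufficient_descent x (z r) /\ x' = embed x (z r)].

End CoordinateDescent.

(* Main.v *)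
Require Import Defs.
From mathcomp Require Import ring lra.

Set Implicit Arguments.
Unset Strict Implicit.
Unset Printing Implicit Defensive.

Local Open Scope classical_set_scope.
Local Open Scope ring_scope.

(** Write [B] for the bound [max sigma_min (tau2 (L + alpha))]. An attempt with
    regularization parameter at least [L + alpha] is accepted, so
    [0 <= sigma_k <= B]. Since [f (x_k)] decreases, [f xs <= f (x_k)] for all
    [k], and the global minimality of the accepted point gives, for all [y] in
    the box,
      f xs <= f x_(k+1)
           <= M_k y + B |y - xb_k|^(p+1) + (L / alpha) (f x_k - f xs),
    the last term bounding [L |x_(k+1) - x_k|^(p+1)] by sufficient descent. The
    right-hand side is a continuous function of [x_k] alone, so the inequality
    passes to the cluster point: [xs_J] is a global minimizer of
    [T_p + B |. - xs_J|^(p+1)]. Restricting to a ray and looking at the first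
    nonzero coefficient gives the stationarity of every order [j <= p]; for
    [sigma]-stationarity of order [j < p], combine this minimality with the
    Taylor expansion [T_p = h + o(|.|^p)] and the bound
    [h <= T_j + gamma |.|^(j+1)], where [gamma < B]. *)

(** * One-sided directional derivatives *)

Lemma near_and (T : topologicalType) (x : T) (P Q : set T) :
  (\forall t \near x, P t) -> (\forall t \near x, Q t) ->
  \forall t \near x, P t /\ Q t.
Proof. exact: filterI. Qed.

Lemma near_imp (T : topologicalType) (x : T) (P Q : set T) :
  (\forall t \near x, P t) -> (forall t, P t -> Q t) -> \forall t \near x, Q t.
Proof. by move=> xP PQ; apply: filterS xP. Qed.

Section DiffIn.
Context {R : realType} {V : normedModType R}.
Implicit Types (D : set V) (h g : V -> R) (x v : V).

Definition diff_in D h x v (w : R) : Prop :=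
  forall e, 0 < e -> \forall t \near (0 : R),
    D (x + t *: v) -> `|h (x + t *: v) - h x - t * w| <= e * `|t|.

Lemma diff_inP D h x v w : diff_in D h x v w <->
  (fun t => t^-1 * (h (x + t *: v) - h x))
    @ within (feasible_steps D x v) 0^' --> w.
Proof.
have key t : t != 0 -> forall e,
    (`|w - t^-1 * (h (x + t *: v) - h x)| <= e) =
    (`|h (x + t *: v) - h x - t * w| <= e * `|t|).
  move=> t0 e; rewrite -ler_pdivrMr ?normr_gt0// -normfV -normrM distrC.
  by congr (`| _ | <= _); field.
split=> [H|/cvgrPdist_le H e e0].
  apply/cvgrPdist_le => e e0; apply: (near_imp (H e e0)) => t Ht t0 Dt.
  by rewrite key// Ht.
have : nbhs (0 : R) [set t | t != 0 -> D (x + t *: v) ->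
    `|w - t^-1 * (h (x + t *: v) - h x)| <= e] by exact: H.
apply: filterS => t Ht Dt.
have [->|t0] := eqVneq t 0.
  by rewrite scale0r addr0 subrr mul0r subr0 normr0 mulr0.
by rewrite -key// Ht.
Qed.

Lemma derivable_in_diff D h x v :
  derivable_in D h x v -> diff_in D h x v (derive_in D v h x).
Proof. by move=> ?; apply/diff_inP. Qed.

(* Without the accumulation hypothesis the filter of admissible increments is
   improper and [derive_in] is an arbitrary value. *)
Lemma derive_in_val D h x v w :
  (forall e, 0 < e -> exists t, [/\ t != 0, `|t| < e & D (x + t *: v)]) ->
  diff_in D h x v w -> derive_in D v h x = w.
Proof.
move=> acc /diff_inP H; apply: cvg_lim => //.
apply: Build_ProperFilter_ex => P /nbhs_ballP[e /= e0 He].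
have [t [t0 te Dt]] := acc e e0.
by exists t; apply: He => //; rewrite /ball /= sub0r normrN.
Qed.

Lemma near0_mulr (c : R) (P : set R) :
  (\forall t \near (0 : R), P t) -> \forall t \near (0 : R), P (t * c).
Proof. exact: (near0Z (c : R^o)). Qed.

Lemma diff_in_scale D h x v w c :
  diff_in D h x v w -> diff_in D h x (c *: v) (c * w).
Proof.
(* Adding one to the absolute value of [c] keeps the divisor positive when [c = 0]. *)
move=> H e e0; have c0 : 0 < 1 + `|c| by have := normr_ge0 c; lra.
apply: (near_imp (near0_mulr c (H _ (divr_gt0 e0 c0)))) => t Ht.
rewrite scalerA mulrA => /Ht/le_trans; apply.
rewrite normrM -mulrA ler_wpM2l ?(ltW e0)//.
rewrite mulrC ler_pdivrMr// ler_wpM2l//; lra.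
Qed.

Lemma diff_inD D g h x v a b :
  diff_in D g x v a -> diff_in D h x v b ->
  diff_in D (fun y => g y + h y) x v (a + b).
Proof.
move=> ga hb e e0; have e20 : 0 < e / 2 by rewrite divr_gt0.
apply: (near_imp (near_and (ga _ e20) (hb _ e20))) => t [gH hH] Dt.
have := lerD (gH Dt) (hH Dt); rewrite -mulrDl -splitr; apply: le_trans.
apply: le_trans (ler_normD _ _).
by rewrite le_eqVlt; apply/orP; left; apply/eqP; congr (`|_|); ring.
Qed.

Lemma diff_inZ D h x v a c :
  diff_in D h x v a -> diff_in D (fun y => c * h y) x v (c * a).
Proof.
move=> H e e0; have c0 : 0 < 1 + `|c| by have := normr_ge0 c; lra.
apply: (near_imp (H _ (divr_gt0 e0 c0))) => t Ht Dt.
have -> : c * h (x + t *: v) - c * h x - t * (c * a) =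
          c * (h (x + t *: v) - h x - t * a) by ring.
rewrite normrM (le_trans (ler_wpM2l (normr_ge0 c) (Ht Dt)))//.
rewrite mulrA ler_wpM2r// mulrCA ger_pMr// ler_pdivrMr//; lra.
Qed.

Lemma diff_in_sum D (J : Type) (r : seq J) (g : J -> V -> R) (a : J -> R) x v :
  (forall j, diff_in D (g j) x v (a j)) ->
  diff_in D (fun y => \sum_(j <- r) g j y) x v (\sum_(j <- r) a j).
Proof.
move=> H; elim: r => [|j r IH].
  rewrite big_nil => e e0; near=> t => _.
  by rewrite !big_nil subrr mulr0 subrr normr0 mulr_ge0// ltW.
rewrite big_cons.
have -> : (fun y => \sum_(i <- j :: r) g i y) =
          (fun y => g j y + \sum_(i <- r) g i y).
  by apply/funext => y; rewrite big_cons.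
exact: diff_inD.
Unshelve. all: end_near. Qed.

End DiffIn.

(** * Mean value theorem with one-sided derivatives *)

Section MeanValue.
Context {R : realType}.

(** Both sides range over the same increments, because moving by [t + s] along [v] is moving by [t]
    and then by [s]. This carries results in one variable over to directional derivatives. *)
Lemma diff_in_line (V : normedModType R) (D : set V) (h : V -> R) (x v : V) t w :
  diff_in D h (x + t *: v) v w <->
  diff_in (V := R^o) [set s | D (x + s *: v)] (fun s => h (x + s *: v)) t 1 w.
Proof.
have E (s : R) : x + (t + s *: (1 : R^o)) *: v = x + t *: v + s *: v.
  by rewrite [s *: _]mulr1 scalerDl addrA.
split=> H e e0; apply: (near_imp (H e e0)) => s.
  by rewrite /= E.
by rewrite /= E.
Qed.

(** At an interior point of [T] all small increments are admissible, so the restricted derivative is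
    the ordinary one. *)
Lemma diff_in_is_derive (T : set R) (phi : R -> R) (t w : R) :
  nbhs t T -> diff_in (V := R^o) T phi t 1 w -> is_derive t 1 phi w.
Proof.
move=> Tt H.
suff C : (fun s : R => s^-1 *: ((phi \o shift t) (s *: 1) - phi t)) @ 0^' --> w.
  by apply: DeriveDef; [apply/cvg_ex; exists w|apply: cvg_lim].
have key s : s != 0 -> forall e,
    (`|w - s^-1 *: ((phi \o shift t) (s *: 1) - phi t)| <= e) =
    (`|phi (t + s *: (1 : R^o)) - phi t - s * w| <= e * `|s|).
  move=> s0 e; rewrite -ler_pdivrMr ?normr_gt0// -normfV -normrM distrC /=.
  congr (`| _ | <= _); rewrite [s *: 1]mulr1 (addrC s) /GRing.scale/=.
  by field.
apply/cvgrPdist_le => e e0.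
have Ts : \forall s \near (0 : R), T (t + s *: (1 : R^o)).
  have : (fun s : R => t + s *: (1 : R^o)) @ (0 : R) --> t.
    rewrite -[X in _ --> X]addr0; apply: cvgD; first exact: cvg_cst.
    rewrite -[X in _ --> X](scale0r (1 : R^o)).
    by apply: cvgZ; [exact: cvg_id|exact: cvg_cst].
  by apply.
suff : nbhs (0 : R) [set s | s != 0 ->
    `|w - s^-1 *: ((phi \o shift t) (s *: 1) - phi t)| <= e] by [].
by apply: (near_imp (near_and Ts (H e e0))) => s [{}Ts Hs] s0; rewrite key// Hs.
Qed.

Lemma diff_in_continuous (T : set R) (phi : R -> R) (t w : R) :
  diff_in (V := R^o) T phi t 1 w -> phi @ within T (nbhs t) --> phi t.
Proof.
move=> H; apply/cvgrPdist_le => e e0.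
have w0 : 0 < 1 + `|w| by have := normr_ge0 w; lra.
have H1 : \forall s \near (0 : R), T (t + s *: (1 : R^o)) ->
   `|phi t - phi (t + s *: (1 : R^o))| <= e.
  have se0 : \forall s \near (0 : R), `|s| <= e / (1 + `|w|).
    exact: (nbhs0_le (divr_gt0 e0 w0)).
  apply: (near_imp (near_and (H 1 ltr01) se0)) => s [Hs se] Ts; rewrite distrC.
  have := Hs Ts; rewrite mul1r => {}Hs.
  have -> : phi (t + s *: (1 : R^o)) - phi t =
    (phi (t + s *: (1 : R^o)) - phi t - s * w) + s * w by ring.
  rewrite (le_trans (ler_normD _ _))// normrM.
  rewrite (le_trans (lerD Hs (lexx _)))//.
  by move: se; rewrite ler_pdivlMr// mulrDr mulr1.
suff : \forall y \near t, T y -> `|phi t - phi y| <= e by [].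
apply/nbhs0P; apply: (near_imp H1) => s.
by rewrite [s *: _]mulr1.
Qed.

(** The classical theorem asks for derivatives in the open interval, where [T] is a neighbourhood of
    each point, and for continuity on the closed one, which the one-sided derivatives at the end
    points provide. *)
Lemma MVT_in (T : set R) (phi dphi : R -> R) (a b : R) : a < b ->
  (forall t, a <= t <= b -> T t) ->
  (forall t, a <= t <= b -> diff_in (V := R^o) T phi t 1 (dphi t)) ->
  exists2 c, a <= c <= b & phi b - phi a = dphi c * (b - a).
Proof.
move=> ab sT H.
have [||c cab ->] := @MVT R phi dphi a b ab.
- move=> t tab.
  have Tt : nbhs t T.
    apply: (near_imp (near_in_itvoo tab)) => s; rewrite in_itv/= =>
      /andP[/ltW ? /ltW ?]; exact/sT/andP.
  apply: (diff_in_is_derive Tt (H t _)).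
  by move: tab; rewrite in_itv/= => /andP[/ltW-> /ltW->].
- apply/subspace_continuousP => t /=; rewrite in_itv/= => tab.
  have /diff_in_continuous C := H t tab.
  move=> W /C CW.
  suff : \forall y \near t, y \in `[a, b] -> W (phi y) by [].
  apply: (near_imp (CW : \forall y \near t, T y -> W (phi y))) => s Ws.
  by rewrite in_itv/= => /sT/Ws.
exists c => //; move: cab; rewrite in_itv/=.
by case/andP=> /ltW-> /ltW->.
Qed.

Lemma MVT01 (V : normedModType R) (D : set V) (g : V -> R) x v (w : R -> R) :
  (forall t, 0 <= t <= 1 -> D (x + t *: v)) ->
  (forall t, 0 <= t <= 1 -> diff_in D g (x + t *: v) v (w t)) ->
  exists2 c, 0 <= c <= 1 & g (x + v) - g x = w c.
Proof.
move=> Dx H.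
have [//|t t01|c c01] := @MVT_in [set t | D (x + t *: v)]
    (fun t => g (x + t *: v)) w 0 1 ltr01.
  by apply/diff_in_line/H.
by rewrite scale1r scale0r addr0 subr0 mulr1 => ?; exists c.
Qed.

End MeanValue.

(** * Chain rule on a box *)

Lemma diff_in_ext (R : realType) (V : normedModType R) (D : set V)
    (g h : V -> R) x v w :
  (forall y, D y -> g y = h y) -> D x ->
  diff_in D g x v w -> diff_in D h x v w.
Proof.
move=> gh Dx H e e0; apply: (near_imp (H e e0)) => t Ht Dt.
by rewrite -!gh//; exact: Ht.
Qed.

Lemma near_forall (T : topologicalType) (x : T) (J : finType) (P : J -> set T) :
  (forall j, \forall t \near x, P j t) -> \forall t \near x, forall j, P j t.
Proof. exact: filter_forall. Qed.

Section Box.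
Context {R : realType} {m : nat}.
Variables (l u : 'rV[R]_m).
Let D := box l u.

Lemma box_segment (x v : 'rV[R]_m) (t : R) :
  D x -> D (x + v) -> 0 <= t <= 1 -> D (x + t *: v).
Proof.
move=> Dx Dv /andP[t0 t1] i; have := Dx i; have := Dv i; rewrite !mxE.
by move=> /andP[? ?] /andP[? ?]; apply/andP; split; nra.
Qed.

Lemma within_near (h : 'rV[R]_m -> R) (x : 'rV[R]_m) e :
  {within D, continuous h} -> D x -> 0 < e ->
  \forall y \near x, D y -> `|h y - h x| <= e.
Proof.
move=> /subspace_continuousP hc Dx e0.
have /cvgrPdist_le/(_ e e0) H := hc x Dx.
by apply: (near_imp (H : \forall y \near x, D y -> _)) => y Hy /Hy; rewrite distrC.
Qed.

(* Go from [x] to [x + t d] changing one coordinate at a time, and apply the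
   mean value theorem to each step. *)
Lemma box_diff (g : 'rV[R]_m -> R) (dg : 'I_m -> 'rV[R]_m -> R) :
  (forall i x, D x -> diff_in D g x (evec i) (dg i x)) ->
  (forall i, {within D, continuous (dg i)}) ->
  forall x d, D x -> diff_in D g x d (\sum_i d 0 i * dg i x).
Proof.
move=> gd gc x d Dx e e0.
(* With tolerance [e / S] on each partial derivative, the errors of the coordinate steps add up to
   at most [e] times the absolute value of [t]. *)
set S := 1 + \sum_i `|d 0 i|.
have S0 : 0 < S by rewrite ltr_pwDl// sumr_ge0.
have eS0 : 0 < e / S by rewrite divr_gt0.
have : \forall y \near x, forall i, D y -> `|dg i y - dg i x| <= e / S.
  by apply: near_forall => i; apply: within_near.
move=> /nbhs_ballP[r /= r0 xr].
have : \forall t \near (0 : R), forall i, `|t * d 0 i| < r.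
  by apply: near_forall => i; exact: (near0_mulr (d 0 i) (nbhs0_lt r0)).
move=> tr; apply: (near_imp tr) => t {}tr Dt.
(* [P j] has the first [j] coordinates of [x + t *: d] and the other ones of [x]; it stays in the
   box because the box is a product of intervals. *)
pose P j : 'rV[R]_m := \row_k (if (k < j)%N then x 0 k + t * d 0 k else x 0 k).
have PS (j : 'I_m) : P j.+1 = P j + (t * d 0 j) *: evec j.
  apply/rowP => k; rewrite !mxE eqxx/= ltnS leq_eqVlt.
  have [<-|kj] := eqVneq k j; first by rewrite eqxx ltnn mulr1.
  by rewrite mulr0 addr0 (_ : (k == j :> nat) = false)//; apply/negbTE.
have DP j : D (P j).
  by move=> k; rewrite mxE; case: ifP => _; [have := Dt k; rewrite !mxE|exact: Dx].
have step (j : 'I_m) :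
    `|g (P j.+1) - g (P j) - t * (d 0 j * dg j x)| <= e / S * (`|d 0 j| * `|t|).
  have Ds s : 0 <= s <= 1 -> D (P j + s *: ((t * d 0 j) *: evec j)).
    by apply: box_segment => //; rewrite -PS.
  have [s s01|c c01] := MVT01 (g := g) (w := fun s =>
      (t * d 0 j) * dg j (P j + s *: ((t * d 0 j) *: evec j))) Ds.
    by apply: diff_in_scale; apply: gd; apply: Ds.
  rewrite -PS => ->.
  rewrite mulrA -mulrBr !normrM (mulrC `|t|) [leLHS]mulrC ler_wpM2r ?mulr_ge0//.
  (* Every coordinate [k] of the intermediate point is within [t * d 0 k], in absolute value, of
     that of [x], hence closer than [r]. *)
  apply: (xr _ _ j (Ds c c01)); split=> // a k.
  rewrite (ord1 a) /ball/= /ball_ /= !mxE eqxx/=.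
  case/andP: c01 => c0 c1.
  have [->|kj] := eqVneq k j.
    rewrite ltnn mulr1 opprD addrA subrr sub0r normrN normrM ger0_norm//.
    by apply: le_lt_trans (tr j); rewrite ler_piMl.
  rewrite !mulr0 addr0; case: ifP => _.
    by rewrite opprD addrA subrr sub0r normrN.
  by rewrite subrr normr0.
have E : g (x + t *: d) - g x = \sum_(j < m) (g (P j.+1) - g (P j)).
  rewrite -(big_mkord xpredT (fun j => g (P j.+1) - g (P j))).
  rewrite (telescope_sumr (fun j => g (P j)))//.
  congr (g _ - g _); apply/rowP => k; rewrite !mxE ?ltn_ord//.
rewrite E mulr_sumr -sumrB (le_trans (ler_norm_sum _ _ _))//.
rewrite (le_trans (ler_sum _ (fun j _ => step j)))//.
rewrite -mulr_sumr -mulr_suml mulrA ler_wpM2r//.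
rewrite -mulrA ger_pMr// mulrC ler_pdivrMr// mul1r /S; lra.
Qed.

(* The [k]-th differential [D^k h(x)[d, ..., d]]. *)
Definition dirpow k (h : 'rV[R]_m -> R) (d x : 'rV[R]_m) : R :=
  \sum_(s : k.-tuple 'I_m) pderivs D h s x * \prod_(i <- s) d 0 i.

Lemma dirpow0 h d x : dirpow 0 h d x = h x.
Proof.
rewrite /dirpow (big_pred1 [tuple]) => [|s]; last by rewrite [s]tuple0 /= eqxx.
by rewrite big_nil mulr1.
Qed.

(** The head is summed innermost since it is the variable differentiated last: for a fixed tail the
    inner sum becomes a directional derivative. *)
Lemma sum_tupleS k (F : seq 'I_m -> R) :
  \sum_(s : k.+1.-tuple 'I_m) F s =
  \sum_(s : k.-tuple 'I_m) \sum_i F (i :: s).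
Proof.
rewrite pair_big/= (reindex (fun q : k.-tuple 'I_m * 'I_m =>
  [tuple of q.2 :: q.1])) //=.
exists (fun s : k.+1.-tuple 'I_m =>
    ([tuple of behead s] : k.-tuple 'I_m, thead s)) => [[s i] _|s _].
  by congr (_, _); apply: val_inj.
by rewrite /= -tuple_eta.
Qed.

(** The products of the [d 0 i] do not depend on the point, and by [box_diff] differentiating a
    partial derivative along [d] puts one more index in front of its tuple. *)
Lemma dirpow_diff p (h : 'rV[R]_m -> R) d x k :
  smooth_in D [set: 'I_m]%SET p h -> (k < p)%N -> D x ->
  diff_in D (dirpow k h d) x d (dirpow k.+1 h d x).
Proof.
move=> [hd hc] kp Dx.
have aT (s : seq 'I_m) : all [in [set: 'I_m]%SET] s.
  by apply/allP => i; rewrite inE.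
rewrite /dirpow (sum_tupleS _ (fun s => pderivs D h s x * \prod_(i <- s) d 0 i)).
apply: diff_in_sum => s.
have -> : (fun y => pderivs D h s y * \prod_(i <- s) d 0 i) =
          (fun y => \prod_(i <- s) d 0 i * pderivs D h s y).
  by apply/funext => y; rewrite mulrC.
have -> : \sum_i pderivs D h (i :: s) x * \prod_(j <- i :: s) d 0 j =
  \prod_(i <- s) d 0 i * \sum_i d 0 i * pderivs D h (i :: s) x.
  by rewrite mulr_sumr; apply: eq_bigr => i _; rewrite big_cons; ring.
apply: diff_inZ.
apply: (box_diff (dg := fun i => pderivs D h (i :: s))) => // [i y Dy|i].
  by apply/derivable_in_diff/hd; rewrite ?aT ?size_tuple ?inE.
by apply: hc; rewrite ?aT //= size_tuple.
Qed.

(** [T] is convex and contains 0 and 1, so none of its points is isolated and [derive_in] takes the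
    value given by [dirpow_diff]. *)
Lemma iter_derive_in p (h : 'rV[R]_m -> R) x y k :
  smooth_in D [set: 'I_m]%SET p h -> (k <= p)%N -> D x -> D y ->
  let T := [set t | D (x + t *: (y - x))] in
  forall t, T t ->
  iter k (derive_in (V := R^o) T 1) (fun t => h (x + t *: (y - x))) t =
  dirpow k h (y - x) (x + t *: (y - x)).
Proof.
move=> hs + Dx Dy T; elim: k => [_ t Tt|k IH kp t Tt]; first by rewrite dirpow0.
rewrite iterS; apply: derive_in_val.
  move=> e e0.
  (* Moving from [t] a small fraction [c] of the way to another point [b] of [T] gives an admissible
     nonzero increment; the 2 in [c] makes its size strictly less than [e]. *)
  have [b [Tb bt]] : exists b, T b /\ b != t.
    have [->|t0] := eqVneq t 0; last first.
      by exists 0; split; [rewrite /T/= scale0r addr0|rewrite eq_sym].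
    by exists 1; split; rewrite ?oner_eq0// /T /= scale1r addrC subrK.
  pose c := Num.min 1 (e / (2 * `|b - t|)).
  have bt0 : 0 < `|b - t| by rewrite normr_gt0 subr_eq0.
  have c0 : 0 < c by rewrite lt_min ltr01 divr_gt0// mulr_gt0.
  exists (c * (b - t)); split.
  - by rewrite mulf_eq0 negb_or (gt_eqF c0)/= subr_eq0.
  - rewrite normrM (gtr0_norm c0).
    have : c <= e / (2 * `|b - t|) by rewrite ge_min lexx orbT.
    by rewrite ler_pdivlMr ?mulr_gt0// => ?; nra.
  - have Db : D (x + t *: (y - x) + (b - t) *: (y - x)).
      by rewrite -addrA -scalerDl (addrC t) subrK; exact: Tb.
    have c01 : 0 <= c <= 1 by rewrite (ltW c0) ge_min lexx.
    have := box_segment Tt Db c01.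
    by rewrite scalerA -addrA -scalerDl /T /= [_ *: 1]mulr1.
(* The induction hypothesis identifies the iterated derivative only on [T], which is all that
   [diff_in] looks at. *)
apply: (@diff_in_ext R R^o T
  (fun t => dirpow k h (y - x) (x + t *: (y - x)))) => //.
  by move=> s Ts; rewrite IH// ltnW.
by apply/diff_in_line; apply: dirpow_diff hs kp Tt.
Qed.

End Box.

(** * Taylor expansions *)

Section TaylorLine.
Context {R : realType}.

Lemma is_derive_diff_in (T : set R) (phi : R -> R) (t w : R) :
  is_derive t 1 phi w -> diff_in (V := R^o) T phi t 1 w.
Proof.
move=> [dphi dw]; apply/diff_inP; apply: cvg_within_filter.
rewrite (_ : (fun s => _) =
    (fun s : R => s^-1 *: ((phi \o shift t) (s *: 1) - phi t))).
  by rewrite -dw; exact: dphi.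
by apply/funext => s /=; rewrite (addrC t).
Qed.

(** Here [phi k] is the [k]-th derivative. By induction on [p], the derivative of the remainder is
    the remainder of order [p - 1] of [phi 1], bounded by [C]; the mean value theorem on [[0, t]]
    then gives the bound [C * t], at most [C]. *)
Lemma taylor_line (T : set R) (C : R) p (phi : nat -> R -> R) :
  (forall t, 0 <= t <= 1 -> T t) ->
  (forall k t, (k < p)%N -> 0 <= t <= 1 ->
     diff_in (V := R^o) T (phi k) t 1 (phi k.+1 t)) ->
  (forall t, 0 <= t <= 1 -> `|phi p t - phi p 0| <= C) ->
  forall t, 0 <= t <= 1 ->
  `|phi 0%N t - \sum_(k < p.+1) (k`!%:R)^-1 * phi k 0 * t ^+ k| <= C.
Proof.
move=> T01; elim: p phi => [|p IH] phi dphi phiC t t01.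
  by rewrite big_ord1 fact0 invr1 mul1r expr0 mulr1; exact: phiC.
have C0 : 0 <= C by apply: le_trans (phiC 0 _); rewrite ?lexx ?ler01.
pose P s := \sum_(k < p.+2) (k`!%:R)^-1 * phi k 0 * s ^+ k.
pose dP s := \sum_(k < p.+1) (k`!%:R)^-1 * phi k.+1 0 * s ^+ k.
have P0 : P 0 = phi 0%N 0.
  rewrite /P big_ord_recl fact0 invr1 mul1r expr0 mulr1 big1 ?addr0// => i _.
  by rewrite /= exprS mul0r mulr0.
have dPP s : diff_in (V := R^o) T P s 1 (dP s).
  have -> : dP s = \sum_(k < p.+2) (k`!%:R)^-1 * phi k 0 * (k%:R * s ^+ k.-1).
    rewrite [RHS]big_ord_recl/= mul0r mulr0 add0r; apply: eq_bigr => i _.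
    rewrite /bump /= add1n factS natrM.
    have i0 : i.+1%:R != 0 :> R by rewrite pnatr_eq0.
    have fi : i`!%:R != 0 :> R by rewrite pnatr_eq0 -lt0n fact_gt0.
    by field; rewrite fi nat1r i0.
  apply: (@diff_in_sum R R^o T _ _
    (fun (k : 'I_p.+2) s => (k`!%:R)^-1 * phi k 0 * s ^+ k)) => k.
  apply: (@diff_inZ R R^o T (fun s => s ^+ k)); apply: is_derive_diff_in.
  have := @is_deriveX R R^o id k s 1 1 (is_derive_id _ _).
  by rewrite exprfctE [_ *: 1]mulr1.
have bnd s : 0 <= s <= 1 -> `|phi 1%N s - dP s| <= C.
  apply: (IH (fun k => phi k.+1)) => [k r kp|//]; exact: dphi.
case/andP: t01 => t0 t1; have [->|tN0] := eqVneq t 0.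
  by rewrite -/(P 0) P0 subrr normr0.
have {}t0 : 0 < t by rewrite lt_neqAle eq_sym tN0.
have s01 s : 0 <= s <= t -> 0 <= s <= 1.
  by case/andP=> -> st; rewrite (le_trans st).
have [s /s01/T01//|s /s01 sI|s /s01 sI E] :=
  @MVT_in R T (fun s => phi 0%N s + -1 * P s)
    (fun s => phi 1%N s + -1 * dP s) 0 t t0.
  apply: (@diff_inD R R^o); first exact: dphi.
  by apply: (@diff_inZ R R^o); exact: dPP.
have -> : phi 0%N t - P t = (phi 1%N s - dP s) * t.
  by move: E; rewrite P0 !mulN1r subrr !subr0.
rewrite normrM (gtr0_norm t0) (le_trans _ (bnd s sI))// ler_piMr//.
Qed.

End TaylorLine.

Section TaylorBox.
Context {R : realType} {m : nat}.
Variables (l u : 'rV[R]_m).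
Let D := box l u.

Lemma normr_coord (v : 'rV[R]_m) i : `|v 0 i| <= `|v|.
Proof.
rewrite [leRHS]mx_normrE.
by apply: (le_bigmax _ (fun ij => `|v ij.1 ij.2|) (0, i)).
Qed.

Lemma normr_prod_coord (v : 'rV[R]_m) (s : seq 'I_m) :
  `|\prod_(i <- s) v 0 i| <= `|v| ^+ size s.
Proof.
elim: s => [|i s IH]; first by rewrite big_nil normr1.
by rewrite big_cons normrM exprS ler_pM// normr_coord.
Qed.

Lemma taylor_dirpow j h x y :
  taylor D j h x y =
  \sum_(k < j.+1) (k`!%:R)^-1 * dirpow l u k h (y - x) x.
Proof. by []. Qed.

Lemma prod_coordZ (c : R) (v : 'rV[R]_m) (s : seq 'I_m) :
  \prod_(i <- s) (c *: v) 0 i = c ^+ size s * \prod_(i <- s) v 0 i.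
Proof.
elim: s => [|i s IH]; first by rewrite !big_nil mulr1.
by rewrite !big_cons IH !mxE exprS; ring.
Qed.

Lemma taylor_ray j h x d t :
  taylor D j h x (x + t *: d) =
  \sum_(k < j.+1) (k`!%:R)^-1 * dirpow l u k h d x * t ^+ k.
Proof.
apply: eq_bigr => k _; rewrite -mulrA; congr (_ * _).
rewrite /dirpow mulr_suml; apply: eq_bigr => s _.
by rewrite addrC addKr prod_coordZ size_tuple; ring.
Qed.

(** By continuity of the partial derivatives of order [p], the differential of order [p] varies
    little along the segment from [x] to [y], and [taylor_line] turns this variation into a bound on
    the remainder. *)
Lemma taylor_peano p h x e :
  smooth_in D [set: 'I_m]%SET p h -> D x -> 0 < e ->
  \forall y \near x, D y -> `|h y - taylor D p h x y| <= e * `|y - x| ^+ p.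
Proof.
move=> hs Dx e0.
(* Each of the [N] tuples is allowed the share [e / (1 + N)] of the error, a quotient that makes
   sense even if [N = 0]. *)
pose N : R := (#|{:p.-tuple 'I_m}|)%:R.
have N0 : 0 <= N by rewrite ler0n.
have eN0 : 0 < e / (1 + N) by rewrite divr_gt0//; lra.
have : \forall y \near x, forall s : p.-tuple 'I_m,
    D y -> `|pderivs D h s y - pderivs D h s x| <= e / (1 + N).
  apply: near_forall => s; apply: within_near => //; apply: hs.2.
    by apply/allP => i; rewrite inE.
  by rewrite size_tuple.
move=> /nbhs_ballP[r /= r0 xr].
have xB : \forall y \near x, ball x r y by exact: nbhsx_ballx.
apply: (near_imp xB) => y xy Dy.
set d := y - x.
have yE : y = x + d by rewrite addrC subrK.
have Dt t : 0 <= t <= 1 -> D (x + t *: d) by apply: box_segment; rewrite -?yE.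
have := @taylor_line R [set t | D (x + t *: d)] (e * `|d| ^+ p) p
  (fun k t => dirpow l u k h d (x + t *: d)) Dt.
move=> /(_ _ _ 1); rewrite lexx ler01 => H.
have := H _ _ isT.
have -> : \sum_(k < p.+1) (k`!%:R)^-1 * dirpow l u k h d (x + 0 *: d) * 1 ^+ k =
  taylor D p h x y.
  rewrite taylor_dirpow; apply: eq_bigr => k _.
  by rewrite scale0r addr0 expr1n mulr1.
rewrite dirpow0 scale1r -yE.
apply=> [k t kp t01|t t01].
  by apply/diff_in_line; apply: dirpow_diff hs kp (Dt t t01).
rewrite scale0r addr0 /dirpow -sumrB.
have b (s : p.-tuple 'I_m) :
    `|pderivs D h s (x + t *: d) * \prod_(i <- s) d 0 i -
    pderivs D h s x * \prod_(i <- s) d 0 i| <= e / (1 + N) * `|d| ^+ p.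
  rewrite -mulrBl normrM ler_pM//.
    apply: xr; last exact: Dt.
    split=> // a k; move: (xy.2 a k); rewrite (ord1 a) /ball/= !mxE.
    rewrite distrC (distrC (x 0 k)) addrAC subrr add0r normrM; apply: le_lt_trans.
    by case/andP: t01 => t0 t1; rewrite ger0_norm// ler_piMl.
  by have := normr_prod_coord d s; rewrite size_tuple.
rewrite (le_trans (ler_norm_sum _ _ _))//.
rewrite (le_trans (ler_sum _ (fun s _ => b s)))//.
rewrite sumr_const -mulr_natl -/N mulrA ler_wpM2r ?exprn_ge0//.
rewrite mulrCA ger_pMr// ler_pdivrMr; lra.
Qed.

End TaylorBox.

(** * Local minima of polynomials in one variable *)

Section PolynomialMinimum.
Context {R : realType}.
Implicit Types (c : nat -> R) (t : R).

Lemma sum_pow_bound c a b t : `|t| <= 1 ->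
  `|\sum_(a <= k < b) c k * t ^+ k| <= (\sum_(0 <= k < b) `|c k|) * `|t| ^+ a.
Proof.
move=> t1; have [ba|ab] := leqP b a.
  by rewrite big_geq// normr0 mulr_ge0 ?exprn_ge0// sumr_ge0.
rewrite [X in _ <= X * _](big_cat_nat (n := a))//= 1?ltnW// mulrDl.
rewrite (le_trans (ler_norm_sum _ _ _))// ler_wpDl//.
  by rewrite mulr_ge0 ?exprn_ge0// sumr_ge0.
rewrite mulr_suml big_nat [leRHS]big_nat ler_sum// => k /andP[ak _].
by rewrite normrM normrX ler_wpM2l// ler_wiXn2l.
Qed.

(* Near [0] the first nonzero coefficient of positive order decides the sign
   of both sums minus [c 0]. *)
Lemma poly_local_min (T : set R) c p S j : (j <= p)%N ->
  (forall t, T t -> c 0%N <= \sum_(k < p.+1) c k * t ^+ k + S * `|t| ^+ p.+1) ->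
  \forall t \near (0 : R), T t -> c 0%N <= \sum_(k < j.+1) c k * t ^+ k.
Proof.
move=> jp H.
have split0 (a q : nat) (t : R) : (forall k, (0 < k < a)%N -> c k = 0) ->
    (0 < a)%N -> (a <= q.+1)%N ->
    \sum_(k < q.+1) c k * t ^+ k = c 0%N + \sum_(a <= k < q.+1) c k * t ^+ k.
  move=> ca a0 aq; rewrite -(big_mkord xpredT (fun k => c k * t ^+ k)).
  rewrite (big_cat_nat (n := a))//=; congr (_ + _).
  rewrite big_ltn// expr0 mulr1 big_nat big1 ?addr0// => k ka.
  by rewrite ca ?mul0r.
(* If all coefficients of orders 1 to [j] vanish, the truncated sum is constant. Otherwise [a] is
   the first order with a nonzero coefficient, and [a <= j]. *)
have [[i /andP[i0 ij] ci]|nc] :=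
  pselect (exists2 i, (0 < i <= j)%N & c i != 0); last first.
  near=> t => _; rewrite (@split0 j.+1)// ?big_geq ?addr0// => k /andP[k0 kj].
  by apply/eqP/negPn/negP => ck; apply: nc; exists k => //; rewrite k0.
have ex : exists i, (0 < i)%N && (c i != 0) by exists i; rewrite i0.
case: (ex_minnP ex) => a /andP[a0 ca] amin.
have caz k : (0 < k < a)%N -> c k = 0.
  case/andP=> k0 ka; apply/eqP/negPn/negP => ck.
  by have := amin k; rewrite k0 ck => /(_ isT); rewrite leqNgt ka.
have aj : (a <= j)%N by rewrite (leq_trans _ ij)// amin// i0.
(* A common constant for the tails of both sums and the term in [S]: beyond order [a] they are at
   most [A] times the power [a.+1] of the size of [t], which the term of order [a] dominates once
   [t] is small. *)
pose A := (\sum_(0 <= k < p.+1) `|c k|) + `|S|.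
have A0 : 0 <= A by rewrite addr_ge0// sumr_ge0.
have near_t : \forall t \near (0 : R), `|t| < Num.min 1 (`|c a| / (1 + A)).
  by apply: nbhs0_lt; rewrite lt_min ltr01 divr_gt0 ?normr_gt0//; lra.
apply: (near_imp near_t) => t; rewrite lt_min => /andP[t1 tA] Tt.
move: tA; rewrite ltr_pdivlMr; last lra.
move=> tA; have {}tA : `|t| * A < `|c a| by have := normr_ge0 t; nra.
have Sj : \sum_(0 <= k < j.+1) `|c k| <= A.
  rewrite /A [X in _ <= X + _](big_cat_nat (n := j.+1))//=.
  by rewrite -addrA lerDl addr_ge0// sumr_ge0.
have := H t Tt; rewrite (split0 a p)// ?(leq_trans aj (leqW jp))//.
rewrite (split0 a j)//; last exact: leqW.
rewrite !(big_ltn (_ : (a < _.+1)%N))//; last exact: leq_trans aj jp.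
have b1 := sum_pow_bound c a.+1 p.+1 (ltW t1).
have b2 := sum_pow_bound c a.+1 j.+1 (ltW t1).
set s1 := \sum_(a.+1 <= k < p.+1) _ in b1 *.
set s2 := \sum_(a.+1 <= k < j.+1) _ in b2 *.
move=> H1.
set X := `|t| ^+ a; have X0 : 0 <= X by exact: exprn_ge0.
have {}b2 : `|s2| <= A * `|t| * X.
  by apply: (le_trans b2); rewrite -mulrA -exprS ler_wpM2r ?exprn_ge0.
have {}b1 : `|s1| + S * `|t| ^+ p.+1 <= A * `|t| * X.
  rewrite -mulrA -exprS mulrDl lerD// (le_trans (ler_norm _))//.
  by rewrite normrM ler_wpM2l// normrX normr_id ler_wiXn2l// ?ltW// ltnS (leq_trans aj).
have cX : `|c a * t ^+ a| = `|c a| * X by rewrite normrM normrX.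
have := ler_norm s1; have := ler_norm (- s2); rewrite normrN => s2n s1n.
(* A nonnegative leading term outweighs the tail [s2]; a negative one outweighs [s1] and the term in
   [S], contradicting the hypothesis at this [t]. *)
have [ct|ct] := lerP 0 (c a * t ^+ a).
  have cAX : A * `|t| * X <= `|c a| * X by rewrite ler_wpM2r// mulrC ltW.
  by move: cX; rewrite ger0_norm// => cX; rewrite lerDl; lra.
have Xgt0 : 0 < X.
  rewrite lt_neqAle X0 andbT; apply/eqP => X00.
  by move: cX; rewrite -X00 mulr0 => /normr0_eq0; lra.
have cAX : A * `|t| * X < `|c a| * X by rewrite ltr_pM2r// mulrC.
by move: cX; rewrite ltr0_norm// => cX; lra.
Unshelve. all: end_near. Qed.

End PolynomialMinimum.

(** * Necessary conditions *)

Section CvgBig.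
Context {R : realType} {T : Type} {F : set_system T} {FF : Filter F} {J : Type}.
Variables (r : seq J) (g : J -> T -> R) (a : J -> R).
Hypothesis ga : forall j, g j @ F --> a j.

Lemma cvg_sumr : (fun t => \sum_(j <- r) g j t) @ F --> \sum_(j <- r) a j.
Proof. by apply: (@cvg_big R J +%R 0 xpredT add_continuous). Qed.

Lemma cvg_prodr : (fun t => \prod_(j <- r) g j t) @ F --> \prod_(j <- r) a j.
Proof. by apply: (@cvg_big R J *%R 1 xpredT mul_continuous). Qed.

End CvgBig.

Section EuclideanNorm.
Context {R : realType} {m : nat}.
Implicit Types (v : 'rV[R]_m).

Lemma enorm_ge0 v : 0 <= enorm v.
Proof. exact: sqrtr_ge0. Qed.

Lemma enormZ (t : R) v : enorm (t *: v) = `|t| * enorm v.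
Proof.
rewrite /enorm -sqrtr_sqr -sqrtrM ?sqr_ge0// mulr_sumr.
by congr Num.sqrt; apply: eq_bigr => i _; rewrite mxE exprMn.
Qed.

Lemma enorm0 : enorm (0 : 'rV[R]_m) = 0.
Proof. by rewrite -(scale0r (0 : 'rV[R]_m)) enormZ normr0 mul0r. Qed.

Lemma normr_le_enorm v : `|v| <= enorm v.
Proof.
rewrite [leLHS]mx_normrE; apply: bigmax_le => [|[a i] _ /=].
  exact: enorm_ge0.
rewrite (ord1 a) -sqrtr_sqr ler_wsqrtr// (bigD1 i)//= lerDl sumr_ge0// => k _.
exact: sqr_ge0.
Qed.

Lemma cvg_enorm (T : Type) (F : set_system T) (g : T -> 'rV[R]_m) v :
  Filter F -> (forall i, (fun t => g t 0 i) @ F --> v 0 i) ->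
  (fun t => enorm (g t)) @ F --> enorm v.
Proof.
move=> FF H; rewrite /enorm; apply: continuous_cvg; first exact: sqrt_continuous.
apply: (@cvg_sumr _ _ _ _ _ _ (fun i t => g t 0 i ^+ 2)) => i.
by rewrite expr2; apply: cvgM; exact: H.
Qed.

Lemma near_enormB v (e : R) : 0 < e -> \forall y \near v, enorm (y - v) <= e.
Proof.
move=> e0; have : (fun y => enorm (y - v)) @ v --> enorm (0 : 'rV[R]_m).
  apply: (cvg_enorm (F := nbhs v) (g := fun y => y - v)) => i.
  rewrite mxE -[X in _ --> X](subrr (v 0 i)).
  rewrite (_ : (fun t => _) = (fun t : 'rV[R]_m => t 0 i - v 0 i)); last first.
    by apply/funext => t; rewrite !mxE.
  by apply: cvgB; [exact: coord_continuous|exact: cvg_cst].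
rewrite enorm0 => /cvgrPdist_le/(_ e e0) H; apply: (near_imp H) => y.
by rewrite sub0r normrN ger0_norm// enorm_ge0.
Qed.

End EuclideanNorm.

Section NecessaryConditions.
Context {R : realType} {m : nat}.
Variables (l u : 'rV[R]_m) (p : nat) (h : 'rV[R]_m -> R) (xs : 'rV[R]_m) (B : R).
Let D := box l u.
Hypotheses (hs : smooth_in D [set: 'I_m]%SET p h) (Dxs : D xs).
Hypothesis hmin : forall y, D y -> h xs <= reg_taylor D p B h xs y.

Lemma reg_taylor_id j s : reg_taylor D j s h xs xs = h xs.
Proof.
rewrite /reg_taylor subrr enorm0 expr0n/= mulr0 addr0.
rewrite -[X in taylor _ _ _ _ X]addr0 -(scale0r (0 : 'rV[R]_m)) taylor_ray.
rewrite big_ord_recl fact0 invr1 mul1r expr0 mulr1 dirpow0 big1 ?addr0// => i _.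
by rewrite /= exprS mul0r mulr0.
Qed.

Lemma reg_taylor_local_min : local_minimizer D (reg_taylor D p B h xs) xs.
Proof.
split=> //; suff : \forall y \near xs, D y ->
    reg_taylor D p B h xs xs <= reg_taylor D p B h xs y by [].
by near=> y => Dy; rewrite reg_taylor_id; exact: hmin.
Unshelve. all: end_near. Qed.

Lemma reg_taylor_stationary j : (j <= p)%N -> stationary j D h xs.
Proof.
move=> jp; split=> // y Dy T phi.
have T0 : T 0 by rewrite /T/= scale0r addr0.
split=> //.
(* By [iter_derive_in] these are both the coefficients of the one-variable Taylor polynomial and
   those of the multivariate one along the ray. *)
pose c k := (k`!%:R)^-1 * dirpow l u k h (y - xs) xs.
have tE t : taylor1 T j phi t = \sum_(k < j.+1) c k * t ^+ k.
  apply: eq_bigr => k _; congr (_ * _ * _).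
  rewrite /phi (iter_derive_in hs _ Dxs Dy T0) ?scale0r ?addr0//.
  by rewrite (leq_trans _ jp)// -ltnS.
have c0 : c 0%N = h xs by rewrite /c fact0 invr1 mul1r dirpow0.
have H := @poly_local_min R T c p (B * enorm (y - xs) ^+ p.+1) j jp.
suff : \forall t \near (0 : R), T t -> taylor1 T j phi 0 <= taylor1 T j phi t by [].
have H1 t : T t -> c 0%N <= \sum_(k < p.+1) c k * t ^+ k +
    B * enorm (y - xs) ^+ p.+1 * `|t| ^+ p.+1.
  move=> Tt; rewrite c0 (le_trans (hmin Tt))// /reg_taylor taylor_ray.
  by rewrite (addrC xs (_ *: _)) addrK enormZ exprMn mulrA [B * _ * _]mulrAC.
apply: (near_imp (H H1)) => t Ht Tt.
rewrite !tE (le_trans _ (Ht Tt))// big_ord_recl expr0 mulr1 big1 ?addr0// => i _.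
by rewrite /= exprS mul0r mulr0.
Qed.

(** For [j < p] the slack [B - gamma] is split in two halves [e]: one absorbs the remainder of
    [taylor_peano], the other the regularization term of order [p.+1]. For [j = p] the minimality of
    [xs] is the claim itself. *)
Lemma reg_taylor_sigma_stationary j gamma : (j <= p)%N -> 0 <= B -> gamma < B ->
  taylor_upper_bound j gamma D h xs -> sigma_stationary j B D h xs.
Proof.
move=> jp B0 gB hg; split; first by exists gamma => //; exact: ltW.
move: jp; rewrite leq_eqVlt => /orP[/eqP->|jp]; first exact: reg_taylor_local_min.
split=> //; suff : \forall y \near xs, D y ->
    reg_taylor D j B h xs xs <= reg_taylor D j B h xs y by [].
pose e := (B - gamma) / 2.
have e0 : 0 < e by rewrite divr_gt0// subr_gt0.
have B1 : 0 < 1 + B by lra.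
(* The bound 1 allows exponents to be lowered; the bound [e / (1 + B)] makes [B * E] at most [e]. *)
have n1 : \forall y \near xs, enorm (y - xs) <= Num.min 1 (e / (1 + B)).
  by apply: near_enormB; rewrite lt_min ltr01 divr_gt0.
have n2 := taylor_peano hs Dxs e0.
apply: (near_imp (near_and n1 n2)) => y [+ yT] Dy; rewrite le_min => /andP[y1 ye].
rewrite reg_taylor_id /reg_taylor.
have := hmin Dy; have := hg y Dy; have := yT Dy; rewrite /reg_taylor.
set E := enorm (y - xs) in y1 ye *.
have E0 : 0 <= E by exact: enorm_ge0.
have p1 : e * `|y - xs| ^+ p <= e * E ^+ j.+1.
  rewrite ler_wpM2l ?(ltW e0)//; apply: (@le_trans _ _ (E ^+ p)).
    by rewrite lerXn2r ?nnegrE// normr_le_enorm.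
  by rewrite ler_wiXn2l.
have p2 : B * E ^+ p.+1 <= e * E ^+ j.+1.
  apply: (@le_trans _ _ (B * E ^+ j.+2)).
    by rewrite ler_wpM2l// ler_wiXn2l.
  rewrite exprS mulrA ler_wpM2r ?exprn_ge0//.
  by move: ye; rewrite ler_pdivlMr//; nra.
have eE : B * E ^+ j.+1 = gamma * E ^+ j.+1 + e * E ^+ j.+1 + e * E ^+ j.+1.
  by rewrite /e; field.
rewrite ler_norml => /andP[h1 h2] h3 h4; lra.
Qed.

End NecessaryConditions.

(** * Restriction to a block of coordinates *)

Lemma fmap_within_congr (T U : Type) (F : set_system T) (S : set T) (f g : T -> U) :
  (forall t, S t -> f t = g t) -> f @ within S F = g @ within S F.
Proof.
move=> fg; apply/funext => W; rewrite /= /nbhs/= /fmap/= /within/=; congr F.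
by apply/seteqP; split=> t Wt St; move: (Wt St); rewrite /preimage/= fg.
Qed.

Section DeriveCongr.
Context {R : realType} {V W : normedModType R}.
Variables (D : set V) (E : set W) (g : V -> R) (h : W -> R).
Variables (x v : V) (y w : W).
Hypotheses (DE : forall t : R, D (x + t *: v) <-> E (y + t *: w)).
Hypotheses (gh : forall t : R, D (x + t *: v) -> g (x + t *: v) = h (y + t *: w)).
Hypothesis Dx : D x.

(** Difference quotients only see the values on the admissible part of the line, so the two filters
    coincide, and with them the existence and the value of the limit. *)
Lemma quotient_congr :
  (fun t : R => t^-1 * (g (x + t *: v) - g x)) @ within (feasible_steps D x v) 0^' =
  (fun t : R => t^-1 * (h (y + t *: w) - h y)) @ within (feasible_steps E y w) 0^'.
Proof.
have -> : feasible_steps E y w = feasible_steps D x v.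
  by apply/seteqP; split=> t /DE.
apply: fmap_within_congr => t Dt; rewrite gh//; congr (_ * (_ - _)).
by have := @gh 0; rewrite !scale0r !addr0; apply.
Qed.

Lemma derive_in_congr : derive_in D v g x = derive_in E w h y.
Proof. by rewrite /derive_in quotient_congr. Qed.

Lemma derivable_in_congr : derivable_in D g x v -> derivable_in E h y w.
Proof. by rewrite /derivable_in quotient_congr. Qed.

End DeriveCongr.

Section Restriction.
Context {R : realType} {n : nat}.
Variables (l u : 'rV[R]_n).
Implicit Types (I : {set 'I_n}) (x : 'rV[R]_n) (f : 'rV[R]_n -> R).

Lemma embed_in I x (z : 'rV[R]_#|I|) a : embed x z 0 (enum_val a) = z 0 a.
Proof.
rewrite mxE; case: pickP => [b /eqP/enum_val_inj -> //|/(_ a)].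
by rewrite eqxx.
Qed.

Lemma embed_out I x (z : 'rV[R]_#|I|) i : i \notin I -> embed x z 0 i = x 0 i.
Proof.
move=> iI; rewrite mxE; case: pickP => // b /eqP bi.
by move: iI; rewrite -bi enum_valP.
Qed.

Lemma enum_val_or_notin I i : (exists a : 'I_#|I|, i = enum_val a) \/ i \notin I.
Proof.
have [iI|] := boolP (i \in I); last by right.
by left; exists (enum_rank_in iI i); rewrite enum_rankK_in.
Qed.

Lemma embed_subvec I x : embed x (subvec I x) = x.
Proof.
apply/rowP => i; have [[a ->]|iI] := enum_val_or_notin I i; last by rewrite embed_out.
by rewrite embed_in mxE.
Qed.

Lemma subvec_embed I x (z : 'rV[R]_#|I|) : subvec I (embed x z) = z.
Proof. by apply/rowP => a; rewrite mxE embed_in. Qed.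

Lemma embed_step I x (z : 'rV[R]_#|I|) (t : R) a :
  embed x (z + t *: evec a) = embed x z + t *: evec (enum_val a).
Proof.
apply/rowP => i; have [[b ->]|iI] := enum_val_or_notin I i.
  rewrite embed_in [LHS]mxE [RHS]mxE embed_in; congr (_ + _).
  by rewrite !mxE !eqxx/= (inj_eq enum_val_inj).
rewrite embed_out// [RHS]mxE embed_out// !mxE.
rewrite (_ : (i == enum_val a) = false) ?andbF ?mulr0 ?addr0//.
by apply/eqP => ia; move: iI; rewrite ia enum_valP.
Qed.

Lemma box_embed I x (z : 'rV[R]_#|I|) :
  box l u x -> box l u (embed x z) <-> subbox l u I z.
Proof.
move=> bx; split=> [bz a|sz i].
  by have := bz (enum_val a); rewrite embed_in !mxE.
have [[a ->]|iI] := enum_val_or_notin I i; last by rewrite embed_out.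
by have := sz a; rewrite embed_in !mxE.
Qed.

Lemma subbox_subvec I x : box l u x -> subbox l u I (subvec I x).
Proof. by move=> bx a; rewrite !mxE. Qed.

(** Moving coordinate [a] of [z] moves coordinate [enum_val a] of the embedded point, inside the box
    for the same increments. The induction keeps [z] general because the difference quotient uses
    displaced points. *)
Lemma pderivs_restr f I x : box l u x -> forall (s : seq 'I_#|I|) z,
  subbox l u I z ->
  pderivs (subbox l u I) (restr f x) s z =
  pderivs (box l u) f (map enum_val s) (embed x z).
Proof.
move=> bx; elim=> [//|a s IH] z Dz /=; apply: derive_in_congr => //.
  by move=> t; rewrite -embed_step box_embed.
by move=> t Dt; rewrite -embed_step; apply: IH.
Qed.

Lemma all_enum_val I (s : seq 'I_#|I|) : all [in I] (map enum_val s).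
Proof. by rewrite all_map; apply/allP => a _ /=; exact: enum_valP. Qed.

Lemma smooth_restr p f I x : smooth_in (box l u) I p f -> box l u x ->
  smooth_in (subbox l u I) [set: 'I_#|I|]%SET p (restr f x).
Proof.
move=> [fd fc] bx; split=> [s a _ _ sp z Dz|s _ sp].
  have bz := (box_embed z bx).2 Dz.
  have H := fd (map enum_val s) (enum_val a) (all_enum_val s) (enum_valP a).
  move: H; rewrite size_map => /(_ sp _ bz).
  apply: derivable_in_congr => //.
    by move=> t; rewrite -embed_step box_embed.
  by move=> t; rewrite -embed_step => /(box_embed _ bx) Dt; rewrite pderivs_restr.
apply/subspace_continuousP => z Dz; have bz := (box_embed z bx).2 Dz.
have H := fc (map enum_val s) (all_enum_val s); rewrite size_map in H.
apply/cvgrPdist_le => e e0.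
suff : \forall y \near z, subbox l u I y ->
    `|pderivs (subbox l u I) (restr f x) s z -
      pderivs (subbox l u I) (restr f x) s y| <= e by [].
have /nbhs_ballP[r /= r0 zr] := within_near (H sp) bz e0.
have zB : \forall y \near z, ball z r y by exact: nbhsx_ballx.
apply: (near_imp zB) => y zy Dy; rewrite !pderivs_restr// distrC.
(* Embedding does not increase the sup-norm distance: outside [I] both points have the coordinates
   of [x]. *)
apply: zr; last exact/box_embed.
split=> // a i; rewrite (ord1 a).
have [[b ->]|iI] := enum_val_or_notin I i; first by rewrite !embed_in; exact: zy.2.
by rewrite !embed_out//; exact: ballxx.
Qed.

(** The restricted function and the base point both vary with [a]. On the box the polynomial equals
    [G a], written with partial derivatives of [f] itself, whose continuity is assumed. *)
Lemma taylor_restr_cvg p f I y x :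
  smooth_in (box l u) I p f -> box l u x ->
  (fun a => taylor (subbox l u I) p (restr f a) (subvec I a) y)
    @ within (box l u) (nbhs x) -->
  taylor (subbox l u I) p (restr f x) (subvec I x) y.
Proof.
move=> [_ fc] bx.
pose G (a : 'rV[R]_n) : R := \sum_(k < p.+1) (k`!%:R)^-1 *
  \sum_(s : k.-tuple 'I_#|I|) pderivs (box l u) f (map enum_val s) a *
    \prod_(i <- s) (y 0 i - a 0 (enum_val i)).
have TG a : box l u a -> taylor (subbox l u I) p (restr f a) (subvec I a) y = G a.
  move=> ba; apply: eq_bigr => k _; congr (_ * _); apply: eq_bigr => s _.
  rewrite pderivs_restr// ?embed_subvec; last exact: subbox_subvec.
  by congr (_ * _); apply: eq_bigr => i _; rewrite !mxE.
rewrite TG// (fmap_within_congr _ TG).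
apply: (@cvg_sumr _ _ _ _ _ _ (fun (k : 'I_p.+1) a => (k`!%:R)^-1 *
  \sum_(s : k.-tuple 'I_#|I|) pderivs (box l u) f (map enum_val s) a *
    \prod_(i <- s) (y 0 i - a 0 (enum_val i)))) => k.
apply: cvgM; first exact: cvg_cst.
apply: (@cvg_sumr _ _ _ _ _ _ (fun (s : k.-tuple 'I_#|I|) a =>
  pderivs (box l u) f (map enum_val s) a *
    \prod_(i <- s) (y 0 i - a 0 (enum_val i)))) => s.
apply: cvgM.
  have := fc (map enum_val s) (all_enum_val s).
  by rewrite size_map size_tuple -ltnS ltn_ord => /(_ isT)/subspace_continuousP; apply.
apply: (@cvg_prodr _ _ _ _ _ _
  (fun (i : 'I_#|I|) (a : 'rV[R]_n) => y 0 i - a 0 (enum_val i))) => i.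
apply: cvgB; first exact: cvg_cst.
by apply: cvg_within_filter; exact: coord_continuous.
Qed.

Lemma enorm_subvec_cvg I (y : 'rV[R]_#|I|) x :
  (fun a => enorm (y - subvec I a)) @ within (box l u) (nbhs x) -->
  enorm (y - subvec I x).
Proof.
apply: (cvg_enorm (F := within (box l u) (nbhs x))
  (g := fun a => y - subvec I a)) => i.
rewrite !mxE (_ : (fun t => _) =
  (fun t : 'rV[R]_n => y 0 i - t 0 (enum_val i))); last first.
  by apply/funext => t; rewrite !mxE.
apply: cvgB; first exact: cvg_cst.
by apply: cvg_within_filter; exact: coord_continuous.
Qed.

End Restriction.

(** * One iteration of the algorithm *)

Section Iteration.
Context {R : realType} {n : nat}.
Variables (l u : 'rV[R]_n) (f : 'rV[R]_n -> R).
Variables (p : nat) (alpha sigma_min tau1 tau2 theta L : R).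
Hypotheses (halpha : 0 < alpha) (hsmin : 0 < sigma_min).
Hypotheses (htau1 : 1 < tau1) (hL : 0 < L).
Variables (x x' : 'rV[R]_n) (I : {set 'I_n}) (M : 'rV[R]_#|I| -> R) (r : nat).
Variables (z : nat -> 'rV[R]_#|I|) (sigma : nat -> R).
Hypothesis halg :
  cd_iteration l u f p alpha sigma_min tau1 tau2 theta x x' M r z sigma.

Lemma cd_box : box l u x -> box l u x'.
Proof.
case: halg => _ _ ht _ [_ ->] bx; apply/box_embed => //.
by case: (ht r (leqnn r)).
Qed.

Lemma cd_descent :
  f x' <= f x - alpha * enorm (subvec I x' - subvec I x) ^+ p.+1.
Proof.
case: halg => _ _ _ _ []; rewrite /sufficient_descent /restr embed_subvec.
by move=> + ->; rewrite subvec_embed.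
Qed.

Hypothesis hmodel : forall i, (i <= r)%N ->
  M (subvec I x) = f x /\
  restr f x (z i) <= M (z i) + L * enorm (z i - subvec I x) ^+ p.+1.

(** Either the first trial point is accepted, with parameter 0, or the last rejected one had a
    parameter below [L + alpha], which the update multiplies by at most [tau2] or replaces by
    [sigma_min]. *)
Lemma cd_sigma_bound : 0 <= sigma r <= Num.max sigma_min (tau2 * (L + alpha)).
Proof.
case: halg => _ [s0 sS] ht hrej _.
have [r0|[i ri]] : r = 0%N \/ exists i, r = i.+1.
  by case: (r) => [|i]; [left|right; exists i].
  by rewrite r0 s0 lexx le_max (ltW hsmin).
have ir : (i < r)%N by rewrite ri.
have [tau /andP[t1 t2] sE] := sS i ir.
rewrite ri sE le_max (ltW hsmin)/= ge_max le_max lexx/= le_max.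
apply/orP; right.
(* Otherwise the bound of [f] by the model plus [L * E], together with the decrease of the
   regularized model, would give a decrease of [f] by at least [alpha * E], that is, acceptance. *)
have si : sigma i < L + alpha.
  rewrite ltNge; apply/negP => Ls; apply: (hrej i ir).
  have [_ h1 _] := ht i (ltnW ir); have [h2 h3] := hmodel (ltnW ir).
  rewrite /sufficient_descent /restr embed_subvec.
  move: h1; rewrite /reg_model h2 => h1; move: h3; rewrite /restr => h3.
  set E := enorm _ ^+ _ in h1 h3 *.
  have E0 : 0 <= E by rewrite exprn_ge0// enorm_ge0.
  rewrite (le_trans h3)// lerBrDr (le_trans _ h1)// -addrA lerD2l -mulrDl.
  exact: ler_wpM2r.
have tau0 : 0 < tau by apply: lt_le_trans t1; apply: lt_trans htau1.
apply: (@le_trans _ _ (tau * (L + alpha))); first by rewrite ler_pM2l// ltW.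
by rewrite ler_wpM2r// addr_ge0// ltW.
Qed.

Hypothesis hmin : global_minimizer (subbox l u I)
  (reg_model p M (subvec I x) (sigma r)) (subvec I x').

(** Sufficient descent bounds the step length by the decrease of [f], so [x'] occurs only through
    [f x']; the next iterate, whose limit is not controlled, can then be eliminated. *)
Lemma cd_upper_model y : subbox l u I y ->
  f x' <= M y + Num.max sigma_min (tau2 * (L + alpha)) *
      enorm (y - subvec I x) ^+ p.+1 + L / alpha * (f x - f x').
Proof.
move=> Dy; have := hmin.2 y Dy; rewrite /reg_model => h1.
have /andP[s0 sB] := cd_sigma_bound.
have [_ h2] := hmodel (leqnn r).
have zr : z r = subvec I x'.
  by case: halg => _ _ _ _ [_ ->]; rewrite subvec_embed.
have xE : restr f x (z r) = f x' by case: halg => _ _ _ _ [_ ->].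
rewrite xE zr in h2; have h3 := cd_descent.
set E := enorm (subvec I x' - _) ^+ _ in h1 h2 h3 *.
set Y := enorm (y - _) ^+ _ in h1 *.
have E0 : 0 <= E by rewrite exprn_ge0// enorm_ge0.
have Y0 : 0 <= Y by rewrite exprn_ge0// enorm_ge0.
have sE : 0 <= sigma r * E by rewrite mulr_ge0.
have sY : sigma r * Y <= Num.max sigma_min (tau2 * (L + alpha)) * Y.
  by rewrite ler_wpM2r.
have LE : L * E <= L / alpha * (f x - f x').
  rewrite -mulrA ler_pM2l// mulrC ler_pdivlMr// mulrC; lra.
lra.
Qed.

End Iteration.

(** * Passage to the limit at a cluster point *)

Lemma cluster_frequently (T : topologicalType) (x : nat -> T) (K : set nat) (xs : T)
    (P : set T) N :
  cluster (x @ within K \oo) xs -> (\forall y \near xs, P y) ->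
  exists k, [/\ K k, (N <= k)%N & P (x k)].
Proof.
move=> hxs xsP.
have xA : (x @ within K \oo) (x @` [set k | K k /\ (N <= k)%N]).
  by exists N => // k /= Nk Kk; exists k.
by have [_ [[k [Kk Nk] <-] Pk]] := hxs _ _ xA xsP; exists k.
Qed.

Lemma box_cluster (R : realType) (n : nat) (l u : 'rV[R]_n) (x : nat -> 'rV[R]_n)
    (K : set nat) (xs : 'rV[R]_n) :
  (forall k, box l u (x k)) -> cluster (x @ within K \oo) xs -> box l u xs.
Proof.
move=> xb hxs i.
have xi : (fun y : 'rV[R]_n => y 0 i) @ nbhs xs --> xs 0 i by exact: coord_continuous.
apply/andP; split; rewrite leNgt; apply/negP => xsi.
  have near : \forall y \near xs, (y : 'rV[R]_n) 0 i < l 0 i by exact: cvgr_lt xi _ xsi.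
  have [k [_ _]] := cluster_frequently 0 hxs near.
  by have /andP[+ _] := xb k i; rewrite leNgt => /negbTE ->.
have near : \forall y \near xs, u 0 i < (y : 'rV[R]_n) 0 i by exact: cvgr_gt xi _ xsi.
have [k [_ _]] := cluster_frequently 0 hxs near.
by have /andP[_ +] := xb k i; rewrite leNgt => /negbTE ->.
Qed.

(** If [G xs < c], continuity within [D] gives [G < c] on [D] near [xs], where some late iterate
    with index in [K] lies. No subsequence is extracted. *)
Lemma cluster_le (R : realType) (T : topologicalType) (D : set T) (x : nat -> T)
    (K : set nat) (xs : T) (G : T -> R) c N :
  (forall k, D (x k)) -> D xs -> cluster (x @ within K \oo) xs ->
  G @ within D (nbhs xs) --> G xs ->
  (forall k, K k -> (N <= k)%N -> c <= G (x k)) -> c <= G xs.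
Proof.
move=> Dx Dxs hxs Gc cG; rewrite leNgt; apply/negP => Gcs.
have near : \forall y \near xs, D y -> G y < c by exact: cvgr_lt Gc _ Gcs.
have [k [Kk Nk /(_ (Dx k))]] := cluster_frequently N hxs near.
by rewrite ltNge cG.
Qed.

Theorem theorem4p4 (R : realType) (n : nat) (l u : 'rV[R]_n)
  (f : 'rV[R]_n -> R)
  (p : nat) (alpha sigma_min tau1 tau2 theta : R)
  (x : nat -> 'rV[R]_n) (I : nat -> {set 'I_n})
  (M : forall k, 'rV[R]_#|I k| -> R)
  (r : nat -> nat) (z : forall k, nat -> 'rV[R]_#|I k|)
  (sigma : nat -> nat -> R)
  (L : R) (K : set nat) (J : {set 'I_n}) (xs : 'rV[R]_n)
  (hlu : forall i, l 0 i < u 0 i)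
  (hf : smooth_in (box l u) [set: 'I_n]%SET 1 f)
  (hp : (0 < p)%N) (halpha : 0 < alpha) (hsigma_min : 0 < sigma_min)
  (htau1 : 1 < tau1) (htau2 : tau1 <= tau2) (htheta : 0 < theta)
  (hx0 : box l u (x 0%N))
  (halg : forall k,
     cd_iteration l u f p alpha sigma_min tau1 tau2 theta
       (x k) (x k.+1) (M k) (r k) (z k) (sigma k))
  (hL : 0 < L)
  (h1 : forall k i, (i <= r k)%N ->
     let xb := subvec (I k) (x k) in
     let fk := restr f (x k) in
     [/\ enorm (grad_in (subbox l u (I k)) fk (z k i) - grad (M k) (z k i))
           <= L * enorm (z k i - xb) ^+ p,
         M k xb = fk xb &
         fk (z k i) <= M k (z k i) + L * enorm (z k i - xb) ^+ p.+1])
  (h2 : forall k,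
     (forall y, M k y =
        taylor (subbox l u (I k)) p (restr f (x k)) (subvec (I k) (x k)) y) /\
     smooth_in (box l u) (I k) p f)
  (h3 : forall k,
     global_minimizer (subbox l u (I k))
       (reg_model p (M k) (subvec (I k) (x k)) (sigma k (r k)))
       (subvec (I k) (x k.+1)))
  (hK : infinite_set K) (hJ : J != finset.set0)
  (hKJ : forall k, K k -> I k = J)
  (hxs : cluster (x @ within K \oo) xs) :
  let D := subbox l u J in
  let h := restr f xs in
  let xsJ := subvec J xs in
  let B := Num.max sigma_min (tau2 * (L + alpha)) in
  (forall j, (j <= p)%N ->
     stationary j D h xsJ /\
     ((exists2 gamma, gamma < B & taylor_upper_bound j gamma D h xsJ) ->
      exists2 sg, sg <= B & sigma_stationary j sg D h xsJ)) /\
  (exists2 sg, sg <= B & local_minimizer D (reg_taylor D p sg h xsJ) xsJ).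
Proof.
move=> D h xsJ B.
have xb k : box l u (x k) by elim: k => // k; exact: cd_box (halg k).
have xsb := box_cluster xb hxs.
have hmodel k i : (i <= r k)%N -> M k (subvec (I k) (x k)) = f (x k) /\
    restr f (x k) (z k i) <=
      M k (z k i) + L * enorm (z k i - subvec (I k) (x k)) ^+ p.+1.
  by move=> /(h1 k)[_ -> ?]; rewrite /restr embed_subvec.
have fdec k : f (x k.+1) <= f (x k).
  apply: le_trans (cd_descent (halg k)) _.
  by rewrite gerBl mulr_ge0 ?(ltW halpha)// exprn_ge0// enorm_ge0.
have fdecr a b : (a <= b)%N -> f (x b) <= f (x a).
  by move/subnK <-; elim: (b - a)%N => // q; apply: le_trans; exact: fdec.
have fc : f @ within (box l u) (nbhs xs) --> f xs.
  by have /subspace_continuousP := hf.2 [::] isT isT; exact.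
(* The tail of indices [q >= k] satisfies [f (x q) <= f (x k)]; since [cluster_le] gives lower
   bounds, it is applied to the opposite of [f]. *)
have fxs k : f xs <= f (x k).
  have fNc : (fun y => - f y) @ within (box l u) (nbhs xs) --> - f xs.
    exact: cvgN.
  rewrite -lerN2.
  apply: (@cluster_le R _ (box l u) x K xs (fun y => - f y) _ k) => // q _ kq.
  by rewrite lerN2 fdecr.
(* [f (x k.+1)] is replaced by the smaller [f xs] on both sides; on the right it occurs with a
   negative sign. *)
have upper k y : subbox l u (I k) y ->
    f xs <= taylor (subbox l u (I k)) p (restr f (x k)) (subvec (I k) (x k)) y +
      B * enorm (y - subvec (I k) (x k)) ^+ p.+1 + L / alpha * (f (x k) - f xs).
  move=> Dy.
  have := cd_upper_model halpha hsigma_min htau1 hL (halg k) (@hmodel k) (h3 k) Dy.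
  rewrite (h2 k).1 -/B => H; rewrite (le_trans (fxs k.+1))// (le_trans H)//.
  rewrite lerD2l; apply: ler_wpM2l; last by rewrite lerD2l lerN2.
  by rewrite divr_ge0// ltW.
(* Some index of [K] is enough to obtain the smoothness of [f] in the variables of [J]. *)
have [k0 [Kk0 _ _]] := cluster_frequently (P := setT) 0 hxs filterT.
have fJ : smooth_in (box l u) J p f by rewrite -(hKJ _ Kk0); exact: (h2 k0).2.
have xsJD : D xsJ by exact: subbox_subvec.
have hs : smooth_in D [set: 'I_#|J|]%SET p h by exact: smooth_restr.
have hmin y : D y -> h xsJ <= reg_taylor D p B h xsJ y.
  move=> Dy; rewrite /h /restr embed_subvec.
  (* The right-hand side of [upper] as a function of the iterate; its last term vanishes at [xs],
     leaving the regularized Taylor polynomial. *)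
  pose G a := taylor D p (restr f a) (subvec J a) y +
    B * enorm (y - subvec J a) ^+ p.+1 + L / alpha * (f a - f xs).
  have -> : reg_taylor D p B h xsJ y = G xs by rewrite /G subrr mulr0 addr0.
  apply: (@cluster_le R _ (box l u) x K xs G _ 0) => // [|k Kk _]; last first.
    by have := @upper k; rewrite (hKJ _ Kk); apply.
  apply: cvgD; last first.
    by apply: cvgM; [exact: cvg_cst|apply: cvgB => //; exact: cvg_cst].
  apply: cvgD; first exact: taylor_restr_cvg.
  apply: cvgM; first exact: cvg_cst.
  apply: (@continuous_cvg _ _ _ _ _ (fun a => enorm (y - subvec J a))
    (fun e : R => e ^+ p.+1)).
    exact: exprn_continuous.
  exact: enorm_subvec_cvg.
have B0 : 0 <= B by rewrite le_max (ltW hsigma_min).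
split; last by exists B => //; exact: reg_taylor_local_min.
move=> j jp; split; first exact: (reg_taylor_stationary hs xsJD hmin jp).
move=> [gamma gB hg]; exists B => //.
exact: (reg_taylor_sigma_stationary hs xsJD hmin jp B0 gB hg).
Qed.
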